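(* Fix an odd prime $p$. For each $n$ let $m=m(n)$ be a nonnegative integer with $m\leq\binom{n+1}{2}-11n\log_p n$, and let $S=\{d_1,\dots,d_m\}\subseteq\mathbb F_p^n$ where $d_1,\dots,d_m$ are chosen independently and uniformly at random from $\mathbb F_p^n$. Then, with probability tending to $1$ as $n\to\infty$, there exists an $n\times n$ matrix $M$ over $\mathbb F_p$ such that $d^\top Md\neq0$ for all $d\in S$. *)

(* Defs.v *)
From mathcomp Require Import all_boot all_order all_algebra.
From mathcomp Require Import all_classical all_reals all_analysis.
Set Implicit Arguments.
Unset Strict Implicit.
Unset Printing Implicit Defensive.
Import Order.TTheory GRing.Theory Num.Theory.
Import numFieldNormedType.Exports.
Local Open Scope ring_scope.

Definition uniform_pmf (R : realType) (T : finType) (x : T) : R := #|T|%:R^-1.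

(* Probability of the event E for (d_1, ..., d_m) sampled independently, each
   with mass function mu: the joint mass is the product of the marginals. *)
Definition iid_pr (R : realType) (T : finType) (m : nat) (mu : T -> R)
    (E : {set {ffun 'I_m -> T}}) : R :=
  \sum_(d in E) \prod_(i < m) mu (d i).

Definition sample_set (T : finType) (m : nat) (d : {ffun 'I_m -> T}) : {set T} :=
  [set d i | i : 'I_m].

Definition nonvanishing_form (p n : nat) (S : {set 'cV['F_p]_n})
    (M : 'M['F_p]_n) : bool :=
  [forall d in S, (d^T *m M *m d) 0 0 != 0].

Definition form_event (p n m : nat) : {set {ffun 'I_m -> 'cV['F_p]_n}} :=
  [set d | [exists M : 'M['F_p]_n, nonvanishing_form (sample_set d) M]].

Definition logb (R : realType) (b x : R) : R := ln x / ln b.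

(* Main.v *)
(** It suffices that no sample d_k is a common zero of the space U of quadratic
    forms vanishing at all other samples: adding up, over k, forms of U that do
    not vanish at d_k gives M.  Since U has codimension at most m among the
    symmetric forms, |U| >= n^(11n).  For common zeros x, y of U, u = x - y and
    v = x + y satisfy u^T A v = 0 for all A in U, so the squared density of the
    set of common zeros is at most the average of p^(-rank A) over U.  As U is
    much larger than the set of matrices of rank at most 5 log_p n, this is at
    most 2 n^-5, and a union bound over the m <= n^2 samples concludes. *)

Require Import Defs.
From mathcomp Require Import all_boot all_order all_algebra.
From mathcomp Require Import all_classical all_reals all_analysis.
From mathcomp Require Import ring.
Set Implicit Arguments.
Unset Strict Implicit.
Unset Printing Implicit Defensive.
Import Order.TTheory GRing.Theory Num.Theory.
Import numFieldNormedType.Exports.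
Local Open Scope ring_scope.

(** * Orthogonal pairs and annihilators over a finite field *)

(** Translating by a multiple of [y0] carries any fibre of [f] on [Y] into any other, so all [#|F|]
    fibres have the same size. *)
Lemma card_scalar_kernel (F : finFieldType) (V : finLmodType F) (Y : {set V})
    (f : V -> F) (y0 : V) :
  linear_closed Y -> scalar f -> y0 \in Y -> f y0 != 0 ->
  (#|F| * #|[set y in Y | f y == 0%R]|)%N = #|Y|.
Proof.
move=> linY linf Yy0 fy0.
have trans_le (a b : F) :
    (#|[set y in Y | f y == a]| <= #|[set y in Y | f y == b]|)%N.
  have inj : injective (fun y : V => ((b - a) / f y0) *: y0 + y) by move=> x y /addrI.
  rewrite -(card_imset _ inj); apply/subset_leq_card/fintype.subsetP.
  move=> _ /imsetP[y /[!inE] /andP[Yy /eqP fy] ->].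
  by rewrite linY//= linf fy divfK// subrK.
rewrite -[RHS]sum1_card (partition_big f xpredT)//= -[LHS]sum_nat_const.
apply: eq_bigr => a _; rewrite sum1dep_card.
by apply/eqP; rewrite eqn_leq !trans_le.
Qed.

(* A nonzero linear form vanishes on exactly 1/q of a subspace, so both sides
   are affine functions of the number of orthogonal pairs in X * Y. *)
Lemma card_orthogonal_pairs (F : finFieldType) (V W : finLmodType F)
    (X : {set V}) (Y : {set W}) (b : V -> W -> F) :
  linear_closed Y -> (forall x, scalar (b x)) ->
  (#|F| * \sum_(x in X) #|[set y in Y | b x y == 0%R]|)%N =
  (#|X| * #|Y| + #|F|.-1 * (#|[set x in X | [forall y in Y, b x y == 0%R]]| * #|Y|))%N.
Proof.
move=> linY linb; rewrite big_distrr/=.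
rewrite -sum_nat_const -[X in (_ + _ * X)%N]sum_nat_const mulnC.
rewrite [in RHS]big_distrl/= big_mkcond [X in (X + _)%N]big_mkcond/=.
rewrite [X in (_ + X)%N]big_mkcond -big_split/=; apply: eq_bigr => x _.
rewrite inE; case: ifP => //= Xx.
have q_gt0 : (0 < #|F|)%N by apply/card_gt0P; exists 0%R.
case: ifPn => [/forallP h|].
  rewrite [in RHS]mulnC -mulSn prednK//; congr (_ * _)%N; apply: eq_card => y.
  by rewrite inE; have := h y; case: (y \in Y).
rewrite negb_forall => /existsP[y]; rewrite negb_imply => /andP[Yy by0].
by rewrite addn0 (card_scalar_kernel linY (linb x) Yy by0).
Qed.

(** Counting orthogonal pairs from either side gives the same total. The term [#|X| * #|Y|] cancels,
    and the factor [#|F|.-1] is positive. *)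
Lemma card_annihilators (F : finFieldType) (V W : finLmodType F)
    (X : {set V}) (Y : {set W}) (b : V -> W -> F) :
  linear_closed X -> linear_closed Y ->
  (forall x, scalar (b x)) -> (forall y, scalar (b^~ y)) ->
  (#|[set x in X | [forall y in Y, b x y == 0%R]]| * #|Y| =
   #|[set y in Y | [forall x in X, b x y == 0%R]]| * #|X|)%N.
Proof.
move=> linX linY linl linr.
have hX := card_orthogonal_pairs X linY linl.
have hY := @card_orthogonal_pairs F W V Y X (fun y x => b x y) linX linr.
have q1 : (0 < #|F|.-1)%N.
  rewrite -subn1 subn_gt0; apply/card_gt1P.
  by exists 0%R, 1%R; rewrite eq_sym oner_neq0.
apply/eqP; rewrite -(eqn_pmul2l q1) -(eqn_add2l (#|X| * #|Y|)%N) -hX.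
rewrite [X in (X + _)%N]mulnC -hY; apply/eqP; congr (_ * _)%N.
under eq_bigr do rewrite -sum1dep_card big_mkcondr.
under [RHS]eq_bigr do rewrite -sum1dep_card big_mkcondr.
by rewrite exchange_big.
Qed.

(** * Common zeros of a space of quadratic forms *)

Definition qform (F : fieldType) (n : nat) (A : 'M[F]_n) (x : 'cV[F]_n) : F :=
  (x^T *m A *m x) 0 0.

Definition common_zeros (F : finFieldType) (n : nat) (U : {set 'M[F]_n}) :
    {set 'cV[F]_n} :=
  [set x | [forall A in U, qform A x == 0]].

Lemma qform_linear (F : fieldType) n (x : 'cV[F]_n) : scalar (fun A => qform A x).
Proof.
by move=> a A B; rewrite /qform mulmxDr mulmxDl -scalemxAr -scalemxAl !mxE.
Qed.

(* For symmetric A, x^T A x - y^T A y = (x - y)^T A (x + y), and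
   (x, y) |-> (x - y, x + y) is injective since 2 is invertible. *)
Lemma card_common_zeros (F : finFieldType) n (U : {set 'M[F]_n}) :
  2%:R != 0 :> F -> linear_closed U -> {in U, forall A, A^T = A} ->
  (#|common_zeros U| ^ 2 * #|U| <=
   #|{: 'cV[F]_n}| * \sum_(A in U) #|[set v : 'cV[F]_n | A *m v == 0%R]|)%N.
Proof.
move=> F2 linU symU.
pose b (v : 'cV[F]_n) (A : 'M[F]_n) (u : 'cV[F]_n) := (u^T *m A *m v) 0 0.
pose B := [set w : 'cV[F]_n * 'cV[F]_n | [forall A in U, b w.1 A w.2 == 0]].
have ZB : (#|common_zeros U| ^ 2 <= #|B|)%N.
  rewrite -mulnn -cardsX.
  pose g (w : 'cV[F]_n * 'cV[F]_n) := (w.1 + w.2, w.1 - w.2).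
  have ginj : injective g.
    move=> [x y] [x' y'] [] e1 e2.
    have two_inj (z z' : 'cV[F]_n) : z + z = z' + z' -> z = z'.
      move=> e; apply: (scalerI F2); rewrite !scaler_nat !mulr2n e//.
    have diffE (z t : 'cV[F]_n) : z + t - (z - t) = t + t.
      by rewrite opprB [t - z]addrC addrACA subrr add0r.
    congr (_, _); apply: two_inj.
      have := congr2 (fun s t => s + t) e1 e2.
      by rewrite addrACA subrr addr0 addrACA subrr addr0.
    have := congr2 (fun s t => s - t) e1 e2.
    by rewrite !diffE.
  rewrite -[X in (X <= _)%N](card_imset _ ginj); apply/subset_leq_card/fintype.subsetP.
  move=> _ /imsetP[[x y] + ->].
  rewrite finset.in_setX !inE/= => /andP[/forallP Zx /forallP Zy].
  apply/forallP => A; apply/implyP => UA.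
  have /eqP xA := implyP (Zx A) UA; have /eqP yA := implyP (Zy A) UA.
  (* Symmetry of [A] makes the two cross terms equal, so they cancel when the product is
     expanded. *)
  have sw : (y^T *m A *m x) 0 0 = (x^T *m A *m y) 0 0.
    transitivity ((y^T *m A *m x)^T 0 0); first by rewrite [RHS]mxE.
    by rewrite !trmx_mul trmxK (symU _ UA) mulmxA.
  rewrite /b/= linearB/= mulmxBl mulmxDr !mulmxBl.
  have addE (P Q : 'M[F]_1) : (P + Q) 0 0 = P 0 0 + Q 0 0 by rewrite mxE.
  have oppE (P : 'M[F]_1) : (- P) 0 0 = - P 0 0 by rewrite mxE.
  move: xA yA; rewrite /qform !(addE, oppE) sw => -> ->.
  by rewrite subr0 sub0r addNr.
apply: leq_trans (leq_mul ZB (leqnn _)) _.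
have cB : #|B| = (\sum_v #|[set u | [forall A in U, b v A u == 0%R]]|)%N.
  rewrite -sum1dep_card; under [RHS]eq_bigr do rewrite -sum1dep_card.
  by rewrite pair_big_dep.
rewrite cB big_distrl/=.
have -> : (\sum_(A in U) #|[set v : 'cV[F]_n | A *m v == 0%R]| =
           \sum_(v : 'cV[F]_n) #|[set A in U | A *m v == 0%R]|)%N.
  under eq_bigr do rewrite -sum1dep_card.
  under [RHS]eq_bigr do rewrite -sum1dep_card.
  by rewrite (exchange_big_dep xpredT).
rewrite big_distrr/=; apply: leq_sum => v _.
have bl A : scalar (b v A).
  by move=> a x y; rewrite /b linearP/= !mulmxDl -!scalemxAl !mxE.
have br u : scalar ((b v)^~ u).
  by move=> a x y; rewrite /b mulmxDr mulmxDl -scalemxAr -scalemxAl !mxE.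
have linT : linear_closed (finset.setT : {set 'cV[F]_n}) by move=> a x y _ _; rewrite finset.in_setT.
(* With [v] fixed, annihilator duality trades the count of [u] orthogonal to all [A *m v] for the
   count of [A] in [U] pairing to zero with every [u]. *)
have := card_annihilators linU linT bl br.
rewrite (_ : [set u in finset.setT | _] = [set u | [forall A in U, b v A u == 0%R]]); last first.
  by apply/setP => u; rewrite !inE.
move=> <-; rewrite cardsT mulnC leq_mul2l; apply/orP; right.
apply/subset_leq_card/fintype.subsetP => A /[!inE] /andP[-> /forallP h]/=.
(* Taking [u] to be a basis vector reads off one entry of [A *m v], hence [A *m v = 0]. *)
apply/eqP/matrixP => i j; have := h (delta_mx i 0); rewrite inE /b/=.
by rewrite trmx_delta -rowE -row_mul !mxE !ord1 => /eqP.
Qed.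

(** * Counting kernel vectors, low-rank matrices and symmetric matrices *)

Lemma card_mulmx_kernel (F : finFieldType) m n (A : 'M[F]_(m, n)) :
  (#|[set v : 'cV[F]_n | A *m v == 0%R]| * #|F| ^ \rank A <= #|F| ^ n)%N.
Proof.
(* [kermx] is a left kernel, so the column kernel of [A] appears transposed, as the row space of
   [K]. *)
set K := kermx A^T.
have rK : (\rank K + \rank A)%N = n by rewrite mxrank_ker mxrank_tr subnK// rank_leq_col.
rewrite -[X in (_ <= _ ^ X)%N]rK expnD leq_mul2r -[X in (_ <= _ ^ X)%N]mul1n -card_mx; apply/orP; right.
pose f (w : 'rV[F]_(\rank K)) := (w *m row_base K)^T.
rewrite -cardsT; apply: leq_trans (leq_imset_card f _).
apply/subset_leq_card/fintype.subsetP => v /[!inE] /eqP Av.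
have : (v^T <= K)%MS by apply/sub_kermxP; rewrite -trmx_mul Av trmx0.
rewrite -(eq_row_base K) => /submxP[w vw]; apply/imsetP; exists w; rewrite ?inE//.
by rewrite /f -vw trmxK.
Qed.

(** Such a matrix factors through dimension [r]; padding the rank factorization with [pid_mx] gives
    factors of fixed shape. *)
Lemma card_low_rank (F : finFieldType) m n r :
  (#|[set A : 'M[F]_(m, n) | (\rank A <= r)%N]| <= #|F| ^ (m * r + r * n))%N.
Proof.
rewrite expnD -!card_mx -card_prod -cardsT.
pose f (w : 'M[F]_(m, r) * 'M[F]_(r, n)) := w.1 *m w.2.
apply: leq_trans (leq_imset_card f _).
apply/subset_leq_card/fintype.subsetP => A /[!inE] rA; apply/imsetP.
exists (col_base A *m pid_mx (\rank A), pid_mx (\rank A) *m row_base A); rewrite ?inE//.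
by rewrite /f/= mulmxA -[X in X *m row_base A]mulmxA pid_mx_id// pid_mx_1 mulmx1 mulmx_base.
Qed.

Lemma card_symmetric (F : finFieldType) n :
  (#|F| ^ 'C(n.+1, 2) <= #|[set A : 'M[F]_n | A^T == A]|)%N.
Proof.
pose P := [set ij : 'I_n * 'I_n | (ij.1 <= ij.2)%N].
have cP : #|P| = 'C(n.+1, 2).
  rewrite -sum1dep_card.
  rewrite -(pair_big_dep xpredT (fun i j : 'I_n => i <= j)%N (fun _ _ => 1%N))/=.
  rewrite (exchange_big_dep xpredT)//= -triangular_sum big_nat_recl// add0n big_mkord.
  apply: eq_bigr => j _; rewrite sum1dep_card.
  rewrite -sum1dep_card -(big_ord_widen n (fun=> 1%N) (ltn_ord j)).
  by rewrite sum_nat_const card_ord muln1.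
pose f (g : {ffun 'I_n * 'I_n -> F}) : 'M[F]_n :=
  \matrix_(i, j) if (i <= j)%N then g (i, j) else g (j, i).
(* [f] reads [g] only on [P], so it is injective once [g] is required to be 0 off [P]. *)
rewrite -cP -(card_pffun_on 0 (mem P) (mem F)).
rewrite -(@card_in_imset _ _ f); last first.
  move=> g h /pffun_onP[/supportP gP _] /pffun_onP[/supportP hP _] /matrixP fgh.
  apply/ffunP => -[i j]; have := fgh i j; rewrite !mxE.
  by case: ifP => // ij _; rewrite gP ?hP ?inE ?ij.
apply/subset_leq_card/fintype.subsetP => _ /imsetP[g _ ->]; rewrite inE.
apply/eqP/matrixP => i j; rewrite !mxE.
by case: ltngtP => // /val_inj ->.
Qed.

(** * Forms vanishing at given points, and the density of their common zeros *)

Definition vanishing_forms (F : finFieldType) n (s : seq 'cV[F]_n) : {set 'M[F]_n} :=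
  [set A | (A^T == A) && all (fun x => qform A x == 0) s].

Lemma vanishing_forms_linear (F : finFieldType) n (s : seq 'cV[F]_n) :
  linear_closed (vanishing_forms s).
Proof.
move=> a A B; rewrite !inE => /andP[/eqP sA /allP zA] /andP[/eqP sB /allP zB].
rewrite linearP/= sA sB eqxx; apply/allP => x sx.
by rewrite qform_linear (eqP (zA _ sx)) (eqP (zB _ sx)) mulr0 addr0.
Qed.

(** Each further point imposes one linear condition, which either holds already or divides the size
    of the space by exactly [#|F|]. *)
Lemma card_vanishing_forms (F : finFieldType) n (s : seq 'cV[F]_n) :
  (#|F| ^ 'C(n.+1, 2) <= #|vanishing_forms s| * #|F| ^ size s)%N.
Proof.
elim: s => [|x s IHs].
  rewrite muln1; apply: leq_trans (card_symmetric F n) _.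
  by apply/subset_leq_card/fintype.subsetP => A; rewrite !inE andbT.
apply: leq_trans IHs _; rewrite /= expnS mulnA leq_mul2r; apply/orP; right.
have kerE : [set A in vanishing_forms s | qform A x == 0] = vanishing_forms (x :: s).
  by apply/setP => A; rewrite !inE /= -andbA [all _ _ && _]andbC.
case: (boolP [forall A in vanishing_forms s, qform A x == 0]) => [/forallP h|].
  apply: (@leq_trans #|vanishing_forms (x :: s)|).
    apply/subset_leq_card/fintype.subsetP => A sA.
    by rewrite -kerE inE sA; have := h A; rewrite sA.
  by rewrite leq_pmulr//; apply/card_gt0P; exists 0%R.
rewrite negb_forall => /existsP[A]; rewrite negb_imply => /andP[sA Ax].
have := card_scalar_kernel (@vanishing_forms_linear F n s) (@qform_linear F n x) sA Ax.
by rewrite kerE mulnC => ->.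
Qed.

(** The kernel sum of [card_common_zeros] is split at rank [r]: low-rank forms are few and get the
    trivial kernel bound, while any other form has a kernel of density at most [#|F|^-(r+1)]. *)
Lemma card_common_zeros_rank (F : finFieldType) n (U : {set 'M[F]_n}) r :
  2%:R != 0 :> F -> linear_closed U -> {in U, forall A, A^T = A} ->
  (#|common_zeros U| ^ 2 * #|U| * #|F| ^ r.+1 <=
   (#|F| ^ n) ^ 2 * (#|F| ^ (n * r + r * n) * #|F| ^ r.+1 + #|U|))%N.
Proof.
move=> F2 linU symU; set Q := (#|F| ^ n)%N.
have cV : #|{: 'cV[F]_n}| = Q by rewrite card_mx muln1.
have := card_common_zeros F2 linU symU; rewrite cV => le1.
apply: leq_trans (leq_mul le1 (leqnn _)) _.
rewrite -mulnn -!mulnA leq_mul2l; apply/orP; right.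
rewrite mulnDr big_distrl/= (bigID (fun A : 'M[F]_n => \rank A <= r)%N)/=.
apply: leq_add.
  apply: (@leq_trans (\sum_(A in U | (\rank A <= r)%N) (Q * #|F| ^ r.+1))).
    by apply: leq_sum => A _; rewrite leq_mul2r -cV max_card orbT.
  rewrite sum_nat_const mulnCA leq_mul2l; apply/orP; right.
  rewrite leq_mul2r; apply/orP; right.
  apply: leq_trans (card_low_rank F n n r).
  by apply/subset_leq_card/fintype.subsetP => A; rewrite !inE => /andP[].
rewrite mulnC -sum_nat_const big_mkcondr/=; apply: leq_sum => A _.
case: ifP => //; rewrite -ltnNge => rA.
apply: leq_trans (card_mulmx_kernel A); rewrite leq_mul2l.
by rewrite leq_exp2l ?rA ?orbT//; apply/card_gt1P; exists 0%R, 1%R; rewrite eq_sym oner_neq0.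
Qed.

(* The threshold r = floor (log_p (n^5)) balances the low-rank forms, of which
   there are at most p^(2nr) <= n^(10n), against the p^-(r+1) <= n^-5
   contributed by each of the others. *)
Lemma card_common_zeros_vanishing p n m (s : seq 'cV['F_p]_n) :
  prime p -> odd p -> (5 <= n)%N -> (size s <= m)%N ->
  (p ^ m * n ^ (11 * n) <= p ^ 'C(n.+1, 2))%N ->
  (#|common_zeros (vanishing_forms s)| ^ 2 * n ^ 5 <= 2 * (p ^ n) ^ 2)%N.
Proof.
move=> p_prime p_odd n5 sm le_m; set U := vanishing_forms s.
have p1 := prime_gt1 p_prime.
have F2 : 2%:R != 0 :> 'F_p.
  rewrite -(dvdn_pcharf (pchar_Fp p_prime)) dvdn_prime2//.
  by apply: contraTneq p_odd => ->.
have symU : {in U, forall A, A^T = A} by move=> A; rewrite inE => /andP[/eqP].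
have n0 : (0 < n)%N by apply: leq_trans n5.
have cU : (n ^ (11 * n) <= #|U|)%N.
  have pm : (0 < p ^ m)%N by rewrite expn_gt0 ltnW.
  rewrite -(leq_pmul2l pm) [leqRHS]mulnC.
  apply: leq_trans le_m _; have := card_vanishing_forms s; rewrite card_Fp//.
  move=> /leq_trans; apply; rewrite leq_mul2l; apply/orP; right.
  by rewrite leq_exp2l.
pose r := trunc_log p (n ^ 5).
have n5_gt0 : (0 < n ^ 5)%N by rewrite expn_gt0 n0.
have pr : (p ^ r <= n ^ 5)%N by apply: trunc_logP.
have pr1 : (n ^ 5 <= p ^ r.+1)%N by apply/ltnW/trunc_log_ltn.
have U_gt0 : (0 < #|U|)%N by apply: leq_trans cU; rewrite expn_gt0 n0.
(* Here [p^(2nr) <= n^(10n)], and [5 <= n] gives [n^5 <= n^n]; together they use up the exponent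
   [11 * n]. *)
have lowU : (p ^ (n * r + r * n) * n ^ 5 <= #|U|)%N.
  apply: leq_trans cU; rewrite mulnC addnC [(n * r)%N]mulnC addnn -muln2 -mulnA expnM.
  rewrite (_ : 11 * n = n + 5 * (n * 2))%N; last first.
    by rewrite mulnCA -mulnS mulnC.
  rewrite expnD [X in (_ <= _ * X)%N]expnM leq_mul//.
    by rewrite leq_exp2l//; apply: leq_trans n5.
  by rewrite leq_exp2r// muln_gt0 n0.
have := card_common_zeros_rank r F2 (@vanishing_forms_linear _ _ s) symU.
rewrite card_Fp// -/U; set X := (_ ^ 2)%N; set Q := (_ ^ 2)%N => le1.
have Up : (0 < #|U| * p ^ r.+1)%N by rewrite muln_gt0 U_gt0 expn_gt0 ltnW.
rewrite -(leq_pmul2r Up) mulnAC mulnA.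
apply: leq_trans (leq_mul le1 (leqnn (n ^ 5)%N)) _.
rewrite -mulnA [(2 * Q)%N]mulnC -mulnA leq_mul2l; apply/orP; right.
(* Each of the two summands is at most [#|U| * p ^ r.+1], whence the factor 2. *)
rewrite mulnDl mul2n -addnn; apply: leq_add.
  by rewrite mulnAC leq_mul2r lowU orbT.
by rewrite leq_mul2l pr1 orbT.
Qed.

(** * Resampling one coordinate, and reduction to one bad event per sample *)

Definition resample (T : finType) m (k : 'I_m) (d : {ffun 'I_m -> T}) (t : T) :
    {ffun 'I_m -> T} :=
  [ffun i => if i == k then t else d i].

(* (d, t) |-> (resample k d t, d k) is an involution, so d k may be replaced by
   a fresh coordinate t when counting the event d k \in G d. *)
Lemma card_mem_resample (T : finType) m (k : 'I_m) (G : {ffun 'I_m -> T} -> {set T}) :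
  (forall d t, G (resample k d t) = G d) ->
  (#|T| * #|[set d : {ffun 'I_m -> T} | d k \in G d]| = \sum_d #|G d|)%N.
Proof.
move=> GE.
rewrite mulnC -sum1dep_card big_distrl/=.
under [LHS]eq_bigr => d _ do rewrite mul1n -sum1_card.
under [RHS]eq_bigr => d _ do rewrite -sum1_card.
rewrite !pair_big_dep/=.
pose h (w : {ffun 'I_m -> T} * T) := (resample k w.1 w.2, w.1 k).
have hK : involutive h.
  move=> [d t]; rewrite /h/= ffunE eqxx; congr (_, _).
  by apply/ffunP => i; rewrite !ffunE; case: eqP => // ->.
rewrite [RHS](reindex_inj (inv_inj hK))/=.
by apply: eq_bigl => -[d t]; rewrite /= GE andbT.
Qed.

(** Removal is by index, not by value: a repeat of [d k] at another index stays, and the list is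
    independent of coordinate [k]. *)
Definition other_samples (T : finType) m (d : {ffun 'I_m -> T}) (k : 'I_m) : seq T :=
  [seq d i | i <- enum 'I_m & i != k].

(* If for every k some form vanishes at all the other samples but not at d k,
   then the sum of these forms vanishes at no sample. *)
Lemma form_eventP p n m (d : {ffun 'I_m -> 'cV['F_p]_n}) :
  (forall k, d k \notin common_zeros (vanishing_forms (other_samples d k))) ->
  d \in form_event p n m.
Proof.
move=> dk.
have {}dk k : exists A : 'M['F_p]_n, (qform A (d k) != 0) &&
    [forall i, (i != k) ==> (qform A (d i) == 0)].
  have := dk k; rewrite inE negb_forall => /existsP[A]; rewrite negb_imply.
  rewrite inE => /andP[/andP[_ /allP Aj] Ak]; exists A; rewrite Ak.
  apply/forallP => i; apply/implyP => ik; apply: Aj.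
  by apply/mapP; exists i; rewrite // mem_filter ik mem_enum.
pose A k := xchoose (dk k).
rewrite inE; apply/existsP; exists (\sum_k A k).
apply/forallP => x; apply/implyP => /imsetP[i _ ->].
rewrite -/(qform _ _) /qform mulmx_sumr mulmx_suml summxE (bigD1 i)//= big1 ?addr0.
  by have /andP[] := xchooseP (dk i).
move=> k ki; have /andP[_ /forallP/(_ i)] := xchooseP (dk k).
by rewrite eq_sym ki => /eqP.
Qed.

Lemma card_le_sum_cover (I T : finType) (A : {set T}) (B : I -> {set T}) :
  (forall x, x \in A -> exists i, x \in B i) -> (#|A| <= \sum_i #|B i|)%N.
Proof.
move=> AB; rewrite -sum1_card; under [leqRHS]eq_bigr do rewrite -sum1_card.
rewrite (exchange_big_dep xpredT)//= big_mkcond/=; apply: leq_sum => x _.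
by case: ifP => // /AB[i Bi]; rewrite (bigD1 i).
Qed.

(** * Probability bound and limit *)

Lemma iid_pr_uniform (R : realType) (T : finType) m (E : {set {ffun 'I_m -> T}}) :
  iid_pr (@uniform_pmf R T) E = #|E|%:R / #|T|%:R ^+ m.
Proof.
rewrite /iid_pr; under eq_bigr do rewrite prodr_const card_ord.
by rewrite sumr_const -[LHS]mulr_natl exprVn.
Qed.

(** A union bound over [k]: the zero set [Z k d] ignores [d k], so by resampling [d k] falls in it
    with probability at most its maximal density [c]. *)
Lemma iid_pr_form_event_ge (R : realType) p n m :
  prime p -> odd p -> (5 <= n)%N ->
  (p ^ m * n ^ (11 * n) <= p ^ 'C(n.+1, 2))%N ->
  1 - m%:R * Num.sqrt (2%:R / n%:R ^+ 5) <=
    iid_pr (@uniform_pmf R 'cV['F_p]_n) (form_event p n m).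
Proof.
move=> p_prime p_odd n5 le_m; set c : R := Num.sqrt _.
have n0 : (0 : R) < n%:R by rewrite ltr0n; apply: leq_trans n5.
have c_ge0 : 0 <= c by apply: sqrtr_ge0.
rewrite iid_pr_uniform; set T := 'cV['F_p]_n.
have cT : #|{: T}| = (p ^ n)%N by rewrite card_mx card_Fp// muln1.
have Q0 : (0 : R) < #|{: T}|%:R by rewrite cT ltr0n expn_gt0 prime_gt0.
have Qm0 : (0 : R) < #|{: T}|%:R ^+ m by rewrite exprn_gt0.
pose Z k (d : {ffun 'I_m -> T}) := common_zeros (vanishing_forms (other_samples d k)).
have Zc k d : #|Z k d|%:R <= #|{: T}|%:R * c.
  rewrite -(@ler_pXn2r _ 2%N)// ?nnegrE ?mulr_ge0//.
  rewrite exprMn sqr_sqrtr ?divr_ge0 ?exprn_ge0//.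
  rewrite mulrA ler_pdivlMr ?exprn_gt0// -!natrX -!natrM ler_nat cT [leqRHS]mulnC.
  apply: card_common_zeros_vanishing le_m => //.
  by rewrite size_map size_filter (leq_trans (count_size _ _))// size_enum_ord.
have Bc k : #|[set d : {ffun 'I_m -> T} | d k \in Z k d]|%:R <= #|{: T}|%:R ^+ m * c.
  have ZE d t : Z k (resample k d t) = Z k d.
    rewrite /Z; congr (common_zeros (vanishing_forms _)).
    apply/eq_in_map => i; rewrite mem_filter ffunE => /andP[/negPf ->//].
  rewrite -(ler_pM2l Q0) -natrM (card_mem_resample ZE) natr_sum.
  apply: le_trans (ler_sum _ (fun d _ => Zc k d)) _.
  by rewrite sumr_const card_ffun card_ord -[leLHS]mulr_natl natrX mulrCA.
(* By [form_eventP], a failing [d] has some [d k] in [Z k d]. *)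
have compl : (#|{ffun 'I_m -> T}| <= #|form_event p n m| +
    \sum_k #|[set d : {ffun 'I_m -> T} | d k \in Z k d]|)%N.
  rewrite -(cardsC (form_event p n m)) leq_add2l; apply: card_le_sum_cover => d.
  rewrite inE => dE; apply/existsP; apply: contraNT dE; rewrite negb_exists => /forallP dZ.
  by apply: form_eventP => k; have := dZ k; rewrite inE.
rewrite ler_pdivlMr// mulrBl mul1r lerBlDr.
rewrite card_ffun card_ord in compl.
rewrite -natrX; apply: (@le_trans _ _ _%:R); first by rewrite ler_nat; exact: compl.
rewrite natrD lerD2l natr_sum.
apply: le_trans (ler_sum _ (fun k _ => Bc k)) _.
by rewrite sumr_const card_ord -[leLHS]mulr_natl natrX mulrA mulrAC.
Qed.

(** Multiplying by [ln p > 0] clears the base of the logarithm; exponentiating then gives an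
    inequality of naturals. *)
Lemma expn_le_of_logb (R : realType) p n m c : prime p -> (0 < n)%N ->
  m%:R <= c%:R - 11%:R * n%:R * logb p%:R n%:R :> R ->
  (p ^ m * n ^ (11 * n) <= p ^ c)%N.
Proof.
move=> p_prime n0 le_m.
have p0 := prime_gt0 p_prime; have p1 := prime_gt1 p_prime.
have lnp : 0 < ln (p%:R : R) by rewrite ln_gt0// ltr1n.
rewrite -(ler_nat R) natrM !natrX -ler_ln ?posrE ?mulr_gt0 ?exprn_gt0 ?ltr0n//.
rewrite lnM ?posrE ?exprn_gt0 ?ltr0n// !lnXn ?ltr0n//.
move: le_m; rewrite -(ler_pM2r lnp) mulrBl /logb mulrA divfK ?gt_eqF//.
by rewrite lerBrDr -[ln p%:R *+ m]mulr_natl -[_ *+ (11 * n)]mulr_natl -[ln p%:R *+ c]mulr_natl natrM.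
Qed.

Local Open Scope classical_set_scope.

Theorem theorem3p1 (R : realType) (p : nat) (p_prime : prime p) (p_odd : odd p)
    (m : nat -> nat)
    (m_le : \forall n \near \oo,
      (m n)%:R <= 'C(n.+1, 2)%:R - 11%:R * n%:R * logb p%:R n%:R :> R) :
  iid_pr (@uniform_pmf R 'cV['F_p]_n) (form_event p n (m n))
    @[n --> \oo] --> (1 : R).
Proof.
(* The lower bound comes from [m n <= n ^ 2], since [n^2 * sqrt (2 / n^5) = sqrt (2 / n)]. *)
apply: (@squeeze_cvgr _ _ _ _ (fun n => 1 - Num.sqrt (2%:R / n%:R)) (fun=> 1)).
- near=> n.
  have n5 : (5 <= n)%N by near: n; exists 5%N.
  have n0 : (0 < n)%N by apply: leq_trans n5.
  have le_m : (p ^ m n * n ^ (11 * n) <= p ^ 'C(n.+1, 2))%N.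
    by apply: (@expn_le_of_logb R) => //; near: n.
  apply/andP; split; last first.
    rewrite iid_pr_uniform ler_pdivrMr ?mul1r.
      by rewrite -natrX ler_nat (leq_trans (max_card _))// card_ffun card_ord.
    by rewrite exprn_gt0// ltr0n card_mx expn_gt0 card_Fp// prime_gt0.
  apply: le_trans (iid_pr_form_event_ge R p_prime p_odd n5 le_m).
  rewrite lerD2l lerN2.
  have m_n2 : (m n <= n ^ 2)%N.
    have : (p ^ m n <= p ^ 'C(n.+1, 2))%N.
      by apply: leq_trans le_m; rewrite leq_pmulr// expn_gt0 n0.
    rewrite leq_exp2l ?prime_gt1// => /leq_trans; apply.
    by rewrite bin2 leq_half_double leqW// -addnn -mulnn mulSn leq_add2r leq_pmulr.
  rewrite (_ : Num.sqrt (2 / n%:R) = n%:R ^+ 2 * Num.sqrt (2%:R / n%:R ^+ 5)).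
    by rewrite ler_wpM2r ?sqrtr_ge0// -natrX ler_nat.
  rewrite -[n%:R ^+ 2]ger0_norm ?exprn_ge0// -sqrtr_sqr -sqrtrM ?sqr_ge0//.
  congr Num.sqrt; have nR0 : n%:R != 0 :> R by rewrite pnatr_eq0 -lt0n.
  by field.
- rewrite -[X in _ --> X]subr0; apply: cvgB; first exact: cvg_cst.
  rewrite -[X in _ --> X]sqrtr0; apply: continuous_cvg; first exact: sqrt_continuous.
  rewrite -[X in _ --> X](mulr0 2%:R); apply: cvgM; first exact: cvg_cst.
  apply/gtr0_cvgV0; last exact: cvgr_idn.
  by exists 1%N => // n /= n0; rewrite ltr0n.
- exact: cvg_cst.
Unshelve. all: by end_near.
Qed.
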